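(* For every $n\ge 2$, the $2$-out graph underlying the Černý automaton $C_n$ is totally simple. Here this graph has vertex set $\{0,1,\dots,n-1\}$; the vertex $0$ has two parallel edges to $1$; and each vertex $i\neq 0$ has exactly two outgoing edges, a self-loop and an edge $i\to i+1$ (modulo $n$).
   Context: A graph is a finite directed multigraph $G=(V,E,s,t)$ with source and target maps $s,t:E\to V$. It is $k$-out if every vertex has exactly $k$ outgoing edges. A coloring of a $k$-out graph $G$ is a map $\chi:E\to[k]=\{1,\dots,k\}$ whose restriction to the set of outgoing edges of each vertex is a bijection onto $[k]$. It defines the deterministic complete automaton $\chi(G)=(V,[k],\delta_\chi)$, where $\delta_\chi(v,a)=t(e)$ for the unique edge $e$ with $s(e)=v$, $\chi(e)=a$. A congruence of an automaton $(Q,\Sigma,\delta)$ is an equivalence relation $\rho$ on $Q$ such that $p\,\rho\,q$ implies $\delta(p,a)\,\rho\,\delta(q,a)$ for all $a\in\Sigma$. An automaton is simple if its only congruences are the discrete (identity) and the universal one. $G$ is totally simple if $\chi(G)$ is simple for every coloring $\chi$ of $G$. *)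

(* Defs.v *)
From mathcomp Require Import all_boot.

Set Implicit Arguments.
Unset Strict Implicit.
Unset Printing Implicit Defensive.

Record multigraph := Multigraph {
  vertex : finType;
  edge : finType;
  source : edge -> vertex;
  target : edge -> vertex }.

Definition out_edge (G : multigraph) (v : vertex G) :=
  {e : edge G | source e == v}.

Record kout_graph (k : nat) := KoutGraph {
  kout_multigraph :> multigraph;
  kout_degree : forall v : vertex kout_multigraph, #|{: out_edge v}| = k }.

(* The colors 1, ..., k are represented by 'I_k, i.e., shifted to 0, ..., k-1. *)
Record coloring (k : nat) (G : kout_graph k) := Coloring {
  color :> edge G -> 'I_k;
  color_bij : forall v : vertex G,
    bijective (fun e : out_edge v => color (val e)) }.

Record automaton (A : finType) := Automaton {
  state : finType;
  delta : state -> A -> state }.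

Section ColoredAutomaton.

Variables (k : nat) (G : kout_graph k) (chi : coloring G).

Lemma color_edge_ex (v : vertex G) (a : 'I_k) :
  exists e : edge G, (source e == v) && (chi e == a).
Proof.
have [g _ gK] := color_bij chi v.
by exists (val (g a)); rewrite (valP (g a)) (gK a) eqxx.
Qed.

Definition color_edge (v : vertex G) (a : 'I_k) : edge G :=
  xchoose (color_edge_ex v a).

Lemma color_edgeP (v : vertex G) (a : 'I_k) (e : edge G) :
  source e = v /\ chi e = a <-> e = color_edge v a.
Proof.
have /andP[/eqP sE /eqP cE] := xchooseP (color_edge_ex v a).
split=> [[se ce]|->]; last by [].
have se' : source e == v by apply/eqP.
have sE' : source (color_edge v a) == v by apply/eqP.
have inj := bij_inj (color_bij chi v).
have /(congr1 val) // : Sub e se' = Sub (color_edge v a) sE' :> out_edge v.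
by apply: inj; rewrite /= ce cE.
Qed.

Definition colored_automaton : automaton 'I_k :=
  Automaton (fun (v : vertex G) (a : 'I_k) => target (color_edge v a)).

End ColoredAutomaton.

Definition congruence (A : finType) (M : automaton A) (rho : rel (state M)) :=
  equivalence_rel rho /\
  forall (p q : state M) (a : A), rho p q -> rho (delta p a) (delta q a).

Definition simple_automaton (A : finType) (M : automaton A) :=
  forall rho : rel (state M), congruence rho ->
    (forall p q, rho p q = (p == q)) \/ (forall p q, rho p q).

Definition totally_simple (k : nat) (G : kout_graph k) :=
  forall chi : coloring G, simple_automaton (colored_automaton chi).

(* The underlying graph of an automaton has one edge p -> delta p a for each
   state p and letter a, so distinct letters give distinct (possibly parallel)
   edges. *)
Definition underlying_multigraph (A : finType) (M : automaton A) : multigraph :=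
  @Multigraph (state M) (state M * A)%type fst (fun e => delta e.1 e.2).

Lemma underlying_degree (k : nat) (M : automaton 'I_k)
    (v : vertex (underlying_multigraph M)) :
  #|{: out_edge v}| = k.
Proof.
pose f (a : 'I_k) : out_edge v := Sub ((v, a) : edge (underlying_multigraph M)) (eqxx v).
have fP : bijective f.
  exists (fun e : out_edge v => (val e).2) => // e; apply: val_inj.
  by case: e => [[p a] /= /eqP ->].
by rewrite -(bij_eq_card fP) card_ord.
Qed.

Definition underlying_graph (k : nat) (M : automaton 'I_k) : kout_graph k :=
  KoutGraph (@underlying_degree k M).

(* The Cerny automaton on 0, ..., n-1: the letter 0 acts as the cyclic
   permutation i |-> i+1 mod n (ordS), and the letter 1 sends 0 to 1 and fixes
   every other state. *)
Definition cerny_automaton (n : nat) : automaton 'I_2 :=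
  Automaton (fun (i : 'I_n) (a : 'I_2) =>
    if (val i == 0) || (a == ord0) then ordS i else i).

Definition cerny_graph (n : nat) : kout_graph 2 :=
  underlying_graph (cerny_automaton n).

(* Main.v *)
(* In any coloring, each letter sends a vertex i to i or to i + 1, some letter
   moves i, and both letters move 0.  If p and q are distinct congruent vertices,
   apply a letter moving p: either q is fixed and p + 1 is congruent to q, hence
   to p, or the pair advances to (p + 1, q + 1).  Once p has reached 0, a letter
   fixing q makes 1 congruent to q, hence to 0.  So some i is congruent to i + 1;
   a letter moving i + 1 then makes i + 1 congruent to i + 2, and so on around the
   cycle. *)

Require Import Defs.
From mathcomp Require Import all_boot.

Lemma val_iter_ordS n (i : 'I_n) k :
  iter k (@ordS n) i = (i + k) %% n :> nat.
Proof.
elim: k => [|k IHk]; first by rewrite addn0 modn_small.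
by rewrite iterS /= IHk -addn1 modnDml addn1 addnS.
Qed.

Lemma iter_ordS_transitive n (i j : 'I_n) : exists k, iter k (@ordS n) i = j.
Proof.
(* [n - i] steps lead from [i] around to 0, and [j] further steps lead to [j]. *)
exists (n - i + j); apply: val_inj.
by rewrite /= val_iter_ordS addnA subnKC 1?ltnW // modnDl modn_small.
Qed.

Section CyclicCongruence.

Variables (n : nat) (A : Type) (d : 'I_n -> A -> 'I_n).
(** These four properties are all that is kept of a coloring; the letter that moves a vertex may
    vary from vertex to vertex. *)
Hypothesis d_stay_or_move : forall i a, d i a = i \/ d i a = ordS i.
Hypothesis d_move : forall i, exists a, d i a = ordS i.
Hypothesis d_move0 : forall (i : 'I_n) a, i = 0 :> nat -> d i a = ordS i.
Hypothesis d_stay : forall i : 'I_n, i <> 0 :> nat -> exists a, d i a = i.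

Variable rho : rel 'I_n.
Hypothesis rho_equiv : equivalence_rel rho.
Hypothesis rho_d : forall p q a, rho p q -> rho (d p a) (d q a).

Let rho_refl : reflexive rho. Proof. by have /equivalence_relP[] := rho_equiv. Qed.
Let rho_ltrans : left_transitive rho.
Proof. by have /equivalence_relP[] := rho_equiv. Qed.
Let rho_sym : symmetric rho.
Proof. by move=> p q; apply/idP/idP => /rho_ltrans <-; exact: rho_refl. Qed.

Lemma congruent_step p q : p != q -> rho p q -> exists i, rho i (ordS i).
Proof.
have step p' q' a : d p' a = ordS p' -> d q' a = q' -> rho p' q' ->
    rho p' (ordS p').
  move=> pa qa pq; have := rho_d _ _ a pq.
  by rewrite pa qa => pq'; rewrite (rho_ltrans _ _ pq) rho_sym.
have [z z0] : exists z : 'I_n, z = 0 :> nat.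
  by exists (Ordinal (leq_ltn_trans (leq0n p) (ltn_ord p))).
(* Induction on the number [k] of steps from [p] to 0, with [q] general since both vertices
   advance. *)
have [k] := iter_ordS_transitive _ p z.
elim: k p q => [|k IHk] p q.
  move=> /= pz neq_pq pq; exists p.
  have p0 : p = 0 :> nat by rewrite pz.
  have [|a qa] := d_stay q.
    by move=> q0; case/eqP: neq_pq; apply: val_inj; rewrite /= p0 q0.
  exact: step _ _ _ (d_move0 p a p0) qa pq.
rewrite iterSr => kp neq_pq pq; have [a pa] := d_move p.
have [qa|qa] := d_stay_or_move q a; first by exists p; apply: step _ _ _ pa qa pq.
apply: (IHk _ (ordS q) kp); first by rewrite (inj_eq (can_inj (@ordSK n))).
by rewrite -pa -qa; apply: rho_d.
Qed.

(** A letter moving [ordS i] either moves [i] too, or fixes it and makes [i] congruent to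
    [ordS (ordS i)]; transitivity through [i] then concludes. *)
Lemma congruent_step_next i : rho i (ordS i) -> rho (ordS i) (ordS (ordS i)).
Proof.
move=> ii'; have [a ia] := d_move (ordS i); have := rho_d _ _ a ii'; rewrite ia.
by have [->|->] := d_stay_or_move i a; rewrite // (rho_ltrans _ _ ii').
Qed.

Lemma cyclic_congruence_trivial :
  (forall p q, rho p q = (p == q)) \/ (forall p q, rho p q).
Proof.
have [/forallP discrete|] := boolP [forall p, forall q, rho p q ==> (p == q)].
  left=> p q; apply/idP/eqP => [pq|->]; last exact: rho_refl.
  by apply/eqP; move/forallP/(_ q)/implyP: (discrete p); apply.
case/forallPn=> p /forallPn[q]; rewrite negb_imply => /andP[pq neq_pq].
have [i ii'] := congruent_step _ _ neq_pq pq.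
have steps k : rho (iter k (@ordS n) i) (iter k.+1 (@ordS n) i).
  by elim: k => // k /congruent_step_next.
have rho_i j : rho i j.
  have [k <-] := iter_ordS_transitive _ i j.
  by elim: k => [|k IHk]; [exact: rho_refl | rewrite (rho_ltrans _ _ IHk)].
by right=> p' q'; rewrite -(rho_ltrans _ _ (rho_i p')).
Qed.

End CyclicCongruence.

Theorem proposition4p5 (n : nat) (hn : 2 <= n) : totally_simple (cerny_graph n).
Proof.
move=> chi rho [rho_equiv rho_delta].
have colorE (e : edge (cerny_graph n)) :
    delta (a := colored_automaton chi) (source e) (chi e) = target e.
  by congr target; apply/esym/(color_edgeP chi).
have sourceE (i : 'I_n) a : (color_edge chi i a).1 = i.
  by have [] := (color_edgeP chi i a _).2 erefl.
apply: (cyclic_congruence_trivial n 'I_2 (@delta _ (colored_automaton chi)))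
  => //.
- by move=> i a /=; rewrite sourceE; case: ifP; [right | left].
(* The moving letter is the color under [chi] of the cycle edge at [i]. *)
- move=> i; exists (chi (i, ord0)).
  by rewrite (colorE (i, ord0)) /= eqxx orbT.
- by move=> i a i0 /=; rewrite sourceE i0.
(* For nonzero [i], the second edge at [i] is a loop; its color fixes [i]. *)
- move=> i i0; exists (chi (i, lift ord0 ord0)).
  by rewrite (colorE (i, lift ord0 ord0)) /= orbF; case: eqP.
Qed.
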